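(* Let $\mathcal{A}$ be a unital complex Banach $*$-algebra with proper involution, and let $a,b,c\in\mathcal{A}$. Then the following are equivalent: (1) $a\in\mathcal{A}_{b,c}^{\mathrm{gg}}$. (2) $a\in\mathcal{A}^{d}$ and there exists an idempotent $p\in\mathcal{A}$ such that $a+p\in\mathcal{A}^{-1}$, $1-p\in\mathcal{A}_{b,c}^{\#}$, $(a^*ap)^*=a^*ap$ and $pa=pap\in\mathcal{A}^{qnil}$. (3) $a\in\mathcal{A}^{d}$ and there exists an idempotent $p\in\mathcal{A}$ such that $a+p\in\mathcal{A}^{-1}$, $1-p\in\mathcal{A}_{b,c}^{\#}$, $(a^d)^*ap=0$ and $pa=pap\in\mathcal{A}^{qnil}$.
   Context: An involution on a complex Banach algebra $\mathcal{A}$ is a map $x\mapsto x^*$ with $(x+y)^*=x^*+y^*$, $(\lambda x)^*=\overline{\lambda}x^*$, $(xy)^*=y^*x^*$, $(x^* )^*=x$; it is proper if $x^*x=0$ implies $x=0$. $\mathcal{A}^{-1}$ is the set of invertible elements. Group inverse: $a\in\mathcal{A}^{\#}$ if there is $x$ with $ax^2=x$, $ax=xa$, $xa^2=a$; it is unique, denoted $a^{\#}$. $(b,c)$-inverse: $a$ has a $(b,c)$-inverse if there is $x$ with $xab=b$, $cax=c$, $x\in b\mathcal{A}x\cap x\mathcal{A}c$; it is unique, denoted $a^{(b,c)}$. $\mathcal{A}_{b,c}^{\#}$ is the set of $a\in\mathcal{A}^{\#}$ such that $a^{(b,c)}$ exists and $a^{\#}=a^{(b,c)}$. Generalized group inverse: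 $a\in\mathcal{A}^{\mathrm{gg}}$ if there is $x$ with $x=ax^2$, $(a^*a^2x)^*=a^*a^2x$, $\lim_{n\to\infty}\|a^n-xa^{n+1}\|^{1/n}=0$; it is unique, denoted $a^{\mathrm{gg}}$. $\mathcal{A}_{b,c}^{\mathrm{gg}}$ is the set of $a\in\mathcal{A}^{\mathrm{gg}}$ such that $a^{(b,c)}$ exists and $a^{\mathrm{gg}}=a^{(b,c)}$. $\mathcal{A}^{qnil}=\{x\in\mathcal{A}:\lim_{n\to\infty}\|x^n\|^{1/n}=0\}$. g-Drazin inverse: $a\in\mathcal{A}^{d}$ if there is $x$ with $ax^2=x$, $ax=xa$, $a-a^2x\in\mathcal{A}^{qnil}$; it is unique, denoted $a^d$. *)

(* Defs.v *)
From HB Require Import structures.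
From mathcomp Require Import all_boot all_order all_algebra.
From mathcomp Require Import complex.
From mathcomp Require Import all_classical all_reals all_analysis.

Set Implicit Arguments.
Unset Strict Implicit.
Unset Printing Implicit Defensive.

Import Order.TTheory GRing.Theory Num.Theory.
Import numFieldNormedType.Exports.

Local Open Scope classical_set_scope.
Local Open Scope complex_scope.
Local Open Scope ring_scope.

(* HB rejects a structure joining CompleteNormedModule and Algebra, because
   NumDomain already combines a ring with a norm.  Hence an ordinary record over
   a complete normed module, whose carrier is then given the canonical instances
   of both structures.  The normalisation `|1| = 1 is not required.
   The involution is purely algebraic: neither continuity nor isometry is
   required. *)
Record banachStarAlgType (R : realType) := BanachStarAlg {
  banach_space : completeNormedModType R[i];
  banach_one : banach_space;
  banach_mul : banach_space -> banach_space -> banach_space;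
  banach_star : banach_space -> banach_space;
  banach_mulA : associative banach_mul;
  banach_mul1x : left_id banach_one banach_mul;
  banach_mulx1 : right_id banach_one banach_mul;
  banach_mulDl : left_distributive banach_mul +%R;
  banach_mulDr : right_distributive banach_mul +%R;
  banach_oner_neq0 : banach_one != 0;
  banach_scalerAl : forall (l : R[i]) x y,
    l *: banach_mul x y = banach_mul (l *: x) y;
  banach_scalerAr : forall (l : R[i]) x y,
    l *: banach_mul x y = banach_mul x (l *: y);
  banach_normM : forall x y, `|banach_mul x y| <= `|x| * `|y|;
  banach_starD : forall x y, banach_star (x + y) = banach_star x + banach_star y;
  banach_starZ : forall (l : R[i]) x,
    banach_star (l *: x) = (l^*)%C *: banach_star x;
  banach_starM : forall x y,
    banach_star (banach_mul x y) = banach_mul (banach_star y) (banach_star x);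
  banach_starK : forall x, banach_star (banach_star x) = x
}.

Definition banach_sort (R : realType) (A : banachStarAlgType R) : Type :=
  banach_space A.
Coercion banach_sort : banachStarAlgType >-> Sortclass.

Section Instances.
Variables (R : realType) (A : banachStarAlgType R).

HB.instance Definition _ := CompleteNormedModule.copy A (banach_space A).
HB.instance Definition _ := GRing.Zmodule_isNzRing.Build A
  (@banach_mulA R A) (@banach_mul1x R A) (@banach_mulx1 R A)
  (@banach_mulDl R A) (@banach_mulDr R A) (@banach_oner_neq0 R A).
HB.instance Definition _ :=
  GRing.Lmodule_isLalgebra.Build R[i] A (@banach_scalerAl R A).
HB.instance Definition _ :=
  GRing.Lalgebra_isAlgebra.Build R[i] A (@banach_scalerAr R A).

Definition star : A -> A := @banach_star R A.

End Instances.

Section Inverses.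
Variables (R : realType) (A : banachStarAlgType R).
Implicit Types a b c p x y : A.

Definition proper_involution : Prop :=
  forall x, star x * x = 0 -> x = 0.

Definition invertible a : Prop := exists x, a * x = 1 /\ x * a = 1.

Definition idempotent_elt p : Prop := p * p = p.

(* The norm of a normed module over R[i] takes its values in R[i], on the
   nonnegative real axis; its real part is the usual norm in R. *)
Definition normR x : R := complex.Re `|x|.

(* ||u_n||^(1/n) --> 0; the junk value at n = 0 is irrelevant. *)
Definition root_norm_cvg0 (u : nat -> A) : Prop :=
  (normR (u n) `^ n%:R^-1) @[n --> \oo] --> (0 : R).

Definition qnil : set A := [set x | root_norm_cvg0 (fun n => x ^+ n)].

Definition is_group_inverse a x : Prop :=
  [/\ a * x ^+ 2 = x, a * x = x * a & x * a ^+ 2 = a].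

Definition is_bc_inverse b c a x : Prop :=
  [/\ x * a * b = b, c * a * x = c,
      exists y, x = b * y * x & exists z, x = x * z * c].

Definition is_gg_inverse a x : Prop :=
  [/\ x = a * x ^+ 2,
      star (star a * a ^+ 2 * x) = star a * a ^+ 2 * x &
      root_norm_cvg0 (fun n => a ^+ n - x * a ^+ n.+1)].

Definition is_gdrazin_inverse a x : Prop :=
  [/\ a * x ^+ 2 = x, a * x = x * a & qnil (a - a ^+ 2 * x)].

(* Each of these relations determines x uniquely (for is_gg_inverse, when the
   involution is proper), so the choice made by xget is immaterial; the value
   is 0 when no inverse exists. *)
Definition group_inverse a : A := xget 0 (is_group_inverse a).
Definition bc_inverse b c a : A := xget 0 (is_bc_inverse b c a).
Definition gg_inverse a : A := xget 0 (is_gg_inverse a).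
Definition gdrazin_inverse a : A := xget 0 (is_gdrazin_inverse a).

Definition group_invertible : set A :=
  [set a | exists x, is_group_inverse a x].
Definition bc_invertible b c : set A :=
  [set a | exists x, is_bc_inverse b c a x].
Definition gg_invertible : set A := [set a | exists x, is_gg_inverse a x].
Definition gdrazin_invertible : set A :=
  [set a | exists x, is_gdrazin_inverse a x].

Definition group_bc b c : set A :=
  [set a | [/\ group_invertible a, bc_invertible b c a &
               group_inverse a = bc_inverse b c a]].

Definition gg_bc b c : set A :=
  [set a | [/\ gg_invertible a, bc_invertible b c a &
               gg_inverse a = bc_inverse b c a]].

End Inverses.

Arguments proper_involution {R} A.
Arguments qnil {R A}.
Arguments group_invertible {R A}.
Arguments gg_invertible {R A}.
Arguments gdrazin_invertible {R A}.

(* Main.v *)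
Require Import Defs.
From HB Require Import structures.
From mathcomp Require Import all_boot all_order all_algebra.
From mathcomp Require Import complex.
From mathcomp Require Import all_classical all_reals all_analysis.
From mathcomp Require Import lra.

Set Implicit Arguments.
Unset Strict Implicit.
Unset Printing Implicit Defensive.

Import Order.TTheory GRing.Theory Num.Theory.
Import numFieldNormedType.Exports.

Local Open Scope classical_set_scope.
Local Open Scope complex_scope.
Local Open Scope ring_scope.

(** All three conditions describe the same element [x], through the idempotent
    [p = 1 - a x].

    Call [x] an outer g-Drazin inverse of [a] if [a x ^ 2 = x] and the norms of
    [a ^ n - x a ^ (n + 1)] decay faster than every geometric sequence.  Then
    [q = a x] is an idempotent, and in block form with respect to [q + p = 1]
    the element [a] is upper triangular, with a diagonal block [q a q] that is
    invertible with inverse [x] and a diagonal block [p a p] that is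
    quasinilpotent.  Conversely, a triangular [a] with quasinilpotent block
    [p a p] has an invertible block [q a q] as soon as [a + p] is invertible,
    because [1 + p a] is invertible; the inverse of that block is an outer
    g-Drazin inverse.  So such [x] correspond to the idempotents [p] with
    [a + p] invertible and [p a = p a p] quasinilpotent
    ([outer_gdrazin_corner], [outer_gdrazin_invertible],
    [outer_gdrazin_exists]).

    The remaining conditions match under this correspondence.  The equation
    defining the generalized group inverse says that [a* a q] is self-adjoint,
    equivalently that [a* a p] is ([gram_compl_selfadjoint]); it is equivalent to
    [(a^d)* a p = 0] because [q] and [a a^d] have the same range
    ([gdrazin_orthogonal]).  And [x] is the [(b, c)]-inverse of [a] exactly when
    [q] is its own ([bc_inverse_outer]).  Finally, an outer g-Drazin inverse
    always yields a g-Drazin inverse, as the limit of [x ^ (n + 1) a ^ n]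
    ([gdrazin_invertible_of_outer]), and properness of the involution makes the
    generalized group inverse unique ([gg_inverse_uniq]).

    The analysis is confined to sequences with [||u n|| ^ (1 / n)] tending to 0.
    They are stable under the algebra operations and under multiplication by
    powers of a fixed element, and only 0 gives such a constant sequence, so an
    estimate on powers of [a] becomes an exact identity
    ([annihilates_range]). *)

(** * Sequences whose norms decay faster than every geometric sequence *)

Section RootNorm.
Variables (R : realType) (A : banachStarAlgType R).
Implicit Types (a x y z : A) (u v : nat -> A).

Lemma normRC x : (normR x)%:C = `|x| :> R[i].
Proof. exact/RRe_real/normr_real. Qed.

Lemma normR_ge0 x : 0 <= normR x.
Proof. by rewrite -lecR normRC normr_ge0. Qed.

Lemma normR_eq0 x : normR x = 0 -> x = 0.
Proof. by move=> x0; apply/normr0_eq0; rewrite -normRC x0. Qed.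

Lemma normRD x y : normR (x + y) <= normR x + normR y.
Proof. by rewrite -lecR rmorphD /= !normRC ler_normD. Qed.

Lemma normRN x : normR (- x) = normR x.
Proof. by rewrite /normR normrN. Qed.

Lemma normRM x y : normR (x * y) <= normR x * normR y.
Proof. by rewrite -lecR rmorphM /= !normRC; exact: banach_normM. Qed.

Lemma normRXl x y n : normR (x ^+ n * y) <= normR x ^+ n * normR y.
Proof.
elim: n => [|n IHn]; first by rewrite !expr0 !mul1r.
rewrite !exprS -!mulrA (le_trans (normRM _ _))//.
by rewrite ler_wpM2l ?normR_ge0.
Qed.

Lemma normRXr x y n : normR (y * x ^+ n) <= normR x ^+ n * normR y.
Proof.
elim: n => [|n IHn]; first by rewrite !expr0 mulr1 mul1r.
rewrite exprSr mulrA (le_trans (normRM _ _))// mulrC exprS -mulrA.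
by rewrite ler_wpM2l ?normR_ge0.
Qed.

Lemma near_geometric_half_lt (C e : R) :
  0 < e -> \forall n \near \oo, C * 2^-1 ^+ n < e.
Proof.
move=> e0; near=> n; rewrite exprVn ltr_pdivrMr ?exprn_gt0// -ltr_pdivrMl//.
rewrite upper_nthrootP//; near: n; exact: nbhs_infty_ge.
Unshelve. all: by end_near. Qed.

(** The constant [C] costs nothing, since [C ^ (1 / n)] tends to 1; allowing it
    makes the condition visibly stable under shifts and under multiplication by
    powers of a fixed element. *)
Lemma root_norm_cvg0P u : root_norm_cvg0 u <->
  forall e : R, 0 < e ->
    exists C : R, \forall n \near \oo, normR (u n) <= C * e ^+ n.
Proof.
split=> [u0 e e0|u0].
  exists 1; have ue := (cvgrPdist_le _ _).1 u0 _ e0.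
  near=> n.
  have n0 : (0 < n)%N by near: n; exact: nbhs_infty_gt.
  have : `|0 - normR (u n) `^ n%:R^-1| <= e by near: n; exact: ue.
  rewrite sub0r normrN ger0_norm ?powR_ge0// => le_e.
  have := ge0_ler_powR (ler0n R n) (powR_ge0 _ _) (ltW e0) le_e.
  rewrite -powRrM mulVf ?pnatr_eq0 -?lt0n// powRr1 ?normR_ge0//.
  by rewrite powR_mulrn ?mul1r// ltW.
apply/cvgrPdist_le => e e0.
(* Decay at rate e / 2 leaves a factor 2 ^ n to absorb the constant. *)
have e20 : 0 < e / 2 by rewrite divr_gt0.
have [C uC] := u0 _ e20.
near=> n.
have n0 : (0 < n)%N by near: n; exact: nbhs_infty_gt.
rewrite sub0r normrN ger0_norm ?powR_ge0//.
have un : normR (u n) <= e `^ n%:R.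
  rewrite powR_mulrn ?(ltW e0)//.
  have -> : e ^+ n = 2 ^+ n * (e / 2) ^+ n.
    by rewrite -exprMn mulrCA divff ?mulr1.
  apply: le_trans (_ : C * (e / 2) ^+ n <= _); first by near: n.
  rewrite ler_wpM2r ?exprn_ge0 ?(ltW e20)//.
  rewrite ltW// upper_nthrootP//; near: n; exact: nbhs_infty_ge.
have := ge0_ler_powR _ (normR_ge0 _) (powR_ge0 _ _) un.
move=> /(_ n%:R^-1); rewrite -powRrM divff ?pnatr_eq0 -?lt0n//.
by rewrite powRr1 ?(ltW e0)// invr_ge0 ler0n => /(_ isT).
Unshelve. all: by end_near. Qed.

(** A geometric loss [M ^ n] is harmless because every rate is available: decay
    at rate [e / (|M| + 1)] of [u] gives decay at rate [e] of [v]. *)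
Lemma root_norm_cvg0_dominated u v (K M : R) :
  (forall n, normR (v n) <= K * M ^+ n * normR (u n)) ->
  root_norm_cvg0 u -> root_norm_cvg0 v.
Proof.
move=> uv /root_norm_cvg0P u0; apply/root_norm_cvg0P => e e0.
have M0 : 0 < `|M| + 1 by rewrite ltr_wpDl.
have [C uC] := u0 (e / (`|M| + 1)) (divr_gt0 e0 M0).
exists (`|K| * C); near=> n; apply: (le_trans (uv n)).
apply: le_trans (_ : `|K| * (`|M| + 1) ^+ n * normR (u n) <= _).
  rewrite ler_wpM2r ?normR_ge0// (le_trans (ler_norm _))// normrM normrX.
  by rewrite ler_wpM2l// lerXn2r ?nnegrE ?(ltW M0)// lerDl.
have -> : `|K| * C * e ^+ n =
    `|K| * (`|M| + 1) ^+ n * (C * (e / (`|M| + 1)) ^+ n).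
  by rewrite mulrACA -exprMn mulrCA divff ?mulr1 // gt_eqF.
by rewrite ler_wpM2l ?mulr_ge0 ?exprn_ge0 ?(ltW M0)//; near: n.
Unshelve. all: by end_near. Qed.

Lemma root_norm_cvg0D u v : root_norm_cvg0 u -> root_norm_cvg0 v ->
  root_norm_cvg0 (fun n => u n + v n).
Proof.
move=> /root_norm_cvg0P u0 /root_norm_cvg0P v0; apply/root_norm_cvg0P => e e0.
have [C uC] := u0 e e0; have [D vD] := v0 e e0; exists (C + D).
near=> n; rewrite mulrDl (le_trans (normRD _ _))// lerD//; near: n.
Unshelve. all: by end_near. Qed.

Lemma root_norm_cvg0N u : root_norm_cvg0 u -> root_norm_cvg0 (fun n => - u n).
Proof.
apply: (@root_norm_cvg0_dominated _ _ 1 1) => n.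
by rewrite normRN expr1n !mul1r.
Qed.

Lemma root_norm_cvg0Ml x u :
  root_norm_cvg0 u -> root_norm_cvg0 (fun n => x * u n).
Proof.
apply: (@root_norm_cvg0_dominated _ _ (normR x) 1) => n.
by rewrite expr1n mulr1 normRM.
Qed.

Lemma root_norm_cvg0Mr x u :
  root_norm_cvg0 u -> root_norm_cvg0 (fun n => u n * x).
Proof.
apply: (@root_norm_cvg0_dominated _ _ (normR x) 1) => n.
by rewrite expr1n mulr1 mulrC normRM.
Qed.

Lemma root_norm_cvg0Xl x u :
  root_norm_cvg0 u -> root_norm_cvg0 (fun n => x ^+ n * u n).
Proof.
apply: (@root_norm_cvg0_dominated _ _ 1 (normR x)) => n.
by rewrite mul1r normRXl.
Qed.

Lemma root_norm_cvg0Xr x u :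
  root_norm_cvg0 u -> root_norm_cvg0 (fun n => u n * x ^+ n).
Proof.
apply: (@root_norm_cvg0_dominated _ _ 1 (normR x)) => n.
by rewrite mul1r normRXr.
Qed.

Lemma root_norm_cvg0S u : root_norm_cvg0 (fun n => u n.+1) <-> root_norm_cvg0 u.
Proof.
split=> /root_norm_cvg0P u0; apply/root_norm_cvg0P => e e0.
  have [C [N _ uC]] := u0 e e0; exists (C / e); exists N.+1 => // -[//|n] Nn.
  by rewrite exprS -mulrA mulKf ?gt_eqF//; apply: uC.
have [C [N _ uC]] := u0 e e0; exists (C * e); exists N => // n Nn.
by rewrite -mulrA -exprS; apply: uC; rewrite /= leqW.
Qed.

(** This is how the limit conditions turn into algebraic identities: a quantity
    independent of [n] that decays must vanish. *)
Lemma root_norm_cvg0_cst x : root_norm_cvg0 (fun=> x) -> x = 0.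
Proof.
move=> /root_norm_cvg0P/(_ 2^-1) []; first by rewrite invr_gt0.
move=> C xC; apply/normR_eq0/le_anti; rewrite normR_ge0 andbT.
apply/ler_addgt0Pr => e e0; rewrite add0r.
near (\oo : set_system nat)%classic => n.
apply: le_trans (_ : C * 2^-1 ^+ n <= _); first by near: n.
by rewrite ltW//; near: n; exact: near_geometric_half_lt.
Unshelve. all: by end_near. Qed.

Lemma root_norm_cvg0_eq u x y : root_norm_cvg0 (fun n => u n - x) ->
  root_norm_cvg0 (fun n => u n - y) -> x = y.
Proof.
move=> ux uy; apply/subr0_eq/root_norm_cvg0_cst.
have := root_norm_cvg0D uy (root_norm_cvg0N ux).
by congr root_norm_cvg0; apply/funext => n; rewrite opprB addrC subrKA.
Qed.

(** Completeness of the algebra enters only here.  The increments are dominated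
    by a geometric sequence, so [u] is Cauchy, and the tails of the geometric
    series show that [u] approaches its limit as fast as its increments decay.
    Limits can then be manipulated with the stability lemmas above, without
    any appeal to the topology. *)
Lemma root_norm_cvg0_increments u :
  root_norm_cvg0 (fun n => u n.+1 - u n) ->
  exists l, root_norm_cvg0 (fun n => u n - l).
Proof.
move=> /root_norm_cvg0P u0.
have tail e : 0 < e -> e <= 2^-1 -> exists2 C, 0 <= C &
    \forall n \near \oo, forall m,
      (n <= m)%N -> normR (u m - u n) <= C * e ^+ n.
  move=> e0 e2; have [C [N _ uC]] := u0 e e0.
  have C0 : 0 <= C.
    have := uC N (leqnn N); move/(le_trans (normR_ge0 _)).
    by rewrite pmulr_lge0 ?exprn_gt0.
  exists (2 * C); first by rewrite mulr_ge0.
  exists N => // n /= Nn m /subnKC <-.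
  (* The bound e <= 1/2 makes 2 * C * e ^ n - 2 * C * e ^ (n + 1) >= C * e ^ n. *)
  have bd k : normR (u (n + k)%N - u n) <=
      2 * C * e ^+ n - 2 * C * e ^+ (n + k).
    elim: k => [|k IHk].
      by rewrite addn0 !subrr -(normRN 0) oppr0 /normR normr0.
    rewrite -[u _ - _](subrKA (u (n + k)%N)) (le_trans (normRD _ _))//.
    rewrite addnS.
    have := uC (n + k)%N (leq_trans Nn (leq_addr _ _)).
    have : 0 <= C * e ^+ (n + k) by rewrite mulr_ge0// exprn_ge0// ltW.
    rewrite /= exprS; nra.
  apply: (le_trans (bd _)); rewrite gerBl mulr_ge0 ?mulr_ge0//.
  by rewrite exprn_ge0// ltW.
have cu : cvg (u n @[n --> \oo]).
  apply/cauchy_cvgP/cauchy_exP => e e0.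
  have half0 : 0 < 2^-1 :> R by rewrite invr_gt0.
  have [C C0 uC] := tail _ half0 (lexx _).
  have e1 : 0 < complex.Re e by move: e0; rewrite ltcE => /andP[].
  have eE : e = (complex.Re e)%:C by rewrite RRe_real// gtr0_real.
  near (\oo : set_system nat)%classic => n.
  exists (u n); exists n => // m /= nm; rewrite -ball_normE /= -normRC eE ltcR.
  rewrite -normRN opprB.
  have um : forall k, (n <= k)%N -> normR (u k - u n) <= C * 2^-1 ^+ n.
    by near: n; exact: uC.
  rewrite (le_lt_trans (um m nm))//; near: n; exact: near_geometric_half_lt.
move/cvg_ex: cu => [l /cvgrPdist_le ul].
exists l; apply/root_norm_cvg0P => e e0.
have e'0 : 0 < Num.min e 2^-1 by rewrite lt_min e0 invr_gt0 ltr0n.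
have e'2 : Num.min e 2^-1 <= 2^-1 by rewrite ge_min lexx orbT.
have [C C0 uC] := tail _ e'0 e'2.
exists (C + 1); near=> n.
have un : forall k, (n <= k)%N ->
    normR (u k - u n) <= C * (Num.min e 2^-1) ^+ n.
  by near: n; exact: uC.
apply: le_trans (_ : (C + 1) * (Num.min e 2^-1) ^+ n <= _); last first.
  rewrite ler_wpM2l ?addr_ge0// lerXn2r ?nnegrE ?(ltW e0) ?(ltW e'0)//.
  by rewrite ge_min lexx.
near (\oo : set_system nat)%classic => m.
rewrite -[u n - l](subrKA (u m)) mulrDl mul1r (le_trans (normRD _ _))//.
rewrite lerD//.
  rewrite -normRN opprB; apply: un; near: m; exact: nbhs_infty_ge.
rewrite -normRN opprB -lecR normRC; near: m; apply: ul.
by rewrite ltcR exprn_gt0.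
Unshelve. all: by end_near. Qed.

End RootNorm.

(** * Involution and invertibility *)

Section Algebra.
Variables (R : realType) (A : banachStarAlgType R).
Implicit Types (a b c p q s u v w x y z : A).

Lemma starD x y : star (x + y) = star x + star y.
Proof. exact: banach_starD. Qed.

Lemma starM x y : star (x * y) = star y * star x.
Proof. exact: banach_starM. Qed.

Lemma starK x : star (star x) = x.
Proof. exact: banach_starK. Qed.

Lemma star0 : star (0 : A) = 0.
Proof. by apply: (addrI (star 0)); rewrite -starD !addr0. Qed.

Lemma starB x y : star (x - y) = star x - star y.
Proof. by apply/eqP; rewrite eq_sym subr_eq -starD subrK. Qed.

Lemma star_gram x : star (star x * x) = star x * x.
Proof. by rewrite starM starK. Qed.

(** Jacobson's lemma: if [w] is the inverse of [1 + u v], then [1 - v w u] is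
    that of [1 + v u]. *)
Lemma invertible_1D_swap u v : invertible (1 + u * v) -> invertible (1 + v * u).
Proof.
move=> [w [wr wl]]; exists (1 - v * w * u); split.
  have vE : (1 + v * u) * (v * w * u) = v * ((1 + u * v) * w) * u.
    by rewrite !mulrDl mulrDr mulrDl !mul1r !mulrA.
  by rewrite mulrBr mulr1 vE wr mulr1 addrK.
have vE : v * w * u * (1 + v * u) = v * (w * (1 + u * v)) * u.
  by rewrite !mulrDr mulrDl !mulr1 !mulrA.
by rewrite mulrBl mul1r vE wl mulr1 addrK.
Qed.

Lemma invertible_of_products u v :
  invertible (u * v) -> invertible (v * u) -> invertible v.
Proof.
move=> [l [_ lP]] [r [rP _]].
have lr : l * u = u * r.
  by rewrite -[LHS]mulr1 -rP !mulrA -(mulrA l) lP mul1r.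
by exists (u * r); split; [rewrite mulrA | rewrite -lr -mulrA].
Qed.

(** Neumann series. *)
Lemma invertible_1D_qnil s : qnil s -> invertible (1 + s).
Proof.
move=> s0; pose v n := \sum_(k < n) (- s) ^+ k.
have Ns0 : root_norm_cvg0 (fun n => (- s) ^+ n).
  have := root_norm_cvg0Xl (-1) s0.
  by congr root_norm_cvg0; apply/funext => n; rewrite -exprNn.
have [l vl] : exists l, root_norm_cvg0 (fun n => v n - l).
  apply: root_norm_cvg0_increments; move: Ns0; congr root_norm_cvg0.
  by apply/funext => n; rewrite /v big_ord_recr/= addrAC subrr add0r.
have vE n : v n * (1 + s) - 1 = - (- s) ^+ n.
  elim: n => [|n IHn]; first by rewrite /v big_ord0 mul0r sub0r expr0.
  rewrite /v big_ord_recr/= mulrDl addrAC IHn mulrDr mulr1 addKr.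
  by rewrite exprSr mulrN opprK.
have Ev n : (1 + s) * v n - 1 = - (- s) ^+ n.
  elim: n => [|n IHn]; first by rewrite /v big_ord0 mulr0 sub0r expr0.
  rewrite /v big_ord_recr/= mulrDr addrAC IHn mulrDl mul1r addKr.
  by rewrite exprS mulNr opprK.
exists l; split.
  apply: (@root_norm_cvg0_eq _ _ (fun n => (1 + s) * v n)).
    have := root_norm_cvg0Ml (1 + s) vl.
    by congr root_norm_cvg0; apply/funext => n; rewrite mulrBr.
  have := root_norm_cvg0N Ns0.
  by congr root_norm_cvg0; apply/funext => n; rewrite Ev.
apply: (@root_norm_cvg0_eq _ _ (fun n => v n * (1 + s))).
  have := root_norm_cvg0Mr (1 + s) vl.
  by congr root_norm_cvg0; apply/funext => n; rewrite mulrBl.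
have := root_norm_cvg0N Ns0.
by congr root_norm_cvg0; apply/funext => n; rewrite vE.
Qed.

(** From [z = a z w] follows [z = a ^ n z w ^ n] for every [n], hence
    [s z = (s a ^ n) z w ^ n] decays while being constant.  The identities
    for outer g-Drazin inverses below come from this principle. *)
Lemma annihilates_range s a z w :
  root_norm_cvg0 (fun n => s * a ^+ n) -> z = a * z * w -> s * z = 0.
Proof.
move=> sa zE; apply: root_norm_cvg0_cst.
have zX n : a ^+ n * z * w ^+ n = z.
  elim: n => [|n IHn]; first by rewrite !expr0 mul1r mulr1.
  rewrite exprSr exprS -mulrA (mulrA z) -!mulrA (mulrA z) (mulrA a) (mulrA a).
  by rewrite -zE mulrA.
have := root_norm_cvg0Xr w (root_norm_cvg0Mr z sa).
congr root_norm_cvg0; apply/funext => n.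
by rewrite -mulrA -mulrA mulrA -{2}(zX n) !mulrA.
Qed.

(** * Outer g-Drazin inverses *)

(** The common part of the definitions of the generalized group inverse and of
    the g-Drazin inverse: the former adds a self-adjointness condition, the
    latter commutation with [a].  Such an [x] is an outer inverse, that is,
    [x a x = x]. *)
Definition outer_gdrazin a x :=
  a * x ^+ 2 = x /\ root_norm_cvg0 (fun n => a ^+ n - x * a ^+ n.+1).

Section OuterGDrazin.
Variables (a x : A).
Hypothesis ax : outer_gdrazin a x.

Lemma outer_gdrazin_left : root_norm_cvg0 (fun n => (1 - x * a) * a ^+ n).
Proof.
case: ax => _; congr root_norm_cvg0; apply/funext => n.
by rewrite mulrBl mul1r -mulrA -exprS.
Qed.

Lemma outer_gdrazin_right : root_norm_cvg0 (fun n => (1 - a * x) * a ^+ n).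
Proof.
case: ax => _ /(root_norm_cvg0Ml a) H; apply/root_norm_cvg0S; move: H.
congr root_norm_cvg0; apply/funext => n.
by rewrite mulrBl mulrBr mul1r -exprS mulrA.
Qed.

Lemma outer_gdrazin_xaX n : x * (a * (a ^+ n * x)) = a ^+ n * x.
Proof.
have : (1 - x * a) * (a ^+ n * x) = 0.
  apply: (annihilates_range (w := x)) outer_gdrazin_left _.
  by rewrite !mulrA -exprS exprSr -!mulrA -expr2; case: ax => ->.
by move/eqP; rewrite mulrBl mul1r subr_eq0 -!mulrA => /eqP.
Qed.

Lemma outer_gdrazin_xax : x * a * x = x.
Proof. by have := outer_gdrazin_xaX 0; rewrite expr0 mul1r mulrA. Qed.

Lemma outer_gdrazin_xaax : x * a * (a * x) = a * x.
Proof. by have := outer_gdrazin_xaX 1; rewrite expr1 mulrA. Qed.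

End OuterGDrazin.

(** The element [1 - a y] is an idempotent commuting with [a], and
    [a - a ^ 2 y] is the product of the two. *)
Lemma spectral_projection_pow a y n : a * y ^+ 2 = y -> a * y = y * a ->
  (a - a ^+ 2 * y) ^+ n.+1 = (1 - a * y) * a ^+ n.+1.
Proof.
move=> ayy ya.
have api : (1 - a * y) * a = a - a ^+ 2 * y.
  by rewrite mulrBl mul1r expr2 -!mulrA -ya.
have id : a * y * (a * y) = a * y.
  by rewrite -mulrA [y * _]mulrA -ya -mulrA -expr2 ayy.
have pi2 : (1 - a * y) * (1 - a * y) = 1 - a * y.
  by rewrite mulrBr mulr1 mulrBl mul1r id subrr subr0.
have comm : a * (1 - a * y) = (1 - a * y) * a.
  by rewrite mulrBl mulrBr mulr1 mul1r -[in RHS]mulrA -ya.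
elim: n => [|n IHn]; first by rewrite !expr1 api.
rewrite exprSr IHn -api mulrA -(mulrA _ _ (1 - _)) -commrX//.
by rewrite ?mulrA ?pi2 -?mulrA -?exprSr.
Qed.

End Algebra.

(** * Existence of the g-Drazin inverse and uniqueness of the other inverses *)

Section GDrazin.
Variables (R : realType) (A : banachStarAlgType R).
Implicit Types (a b c p q s u v w x y z : A).

Lemma gdrazin_spectral a y : a * y ^+ 2 = y -> a * y = y * a ->
  qnil (a - a ^+ 2 * y) <-> root_norm_cvg0 (fun n => (1 - a * y) * a ^+ n).
Proof.
move=> ayy ya; rewrite -(root_norm_cvg0S (fun n => (1 - a * y) * a ^+ n)).
rewrite /qnil /= -root_norm_cvg0S.
by under eq_fun do rewrite spectral_projection_pow//.
Qed.

(** The g-Drazin inverse is the limit [y] of [v n = x ^ (n + 1) a ^ n]: the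
    increments of [v] are [- x ^ (n + 1) (a ^ n - x a ^ (n + 1))].  Since
    [a v (n + 1) = v n a], the limit commutes with [a].  Both [a x] and [a y] are
    idempotents with the same range, so [1 - a y] kills [a x] and
    [(1 - a y) a ^ n] inherits the decay of [(1 - a x) a ^ n]. *)
Lemma gdrazin_invertible_of_outer a x :
  outer_gdrazin a x -> gdrazin_invertible a.
Proof.
move=> ax; have [axx xlim] := ax.
pose v n := x ^+ n.+1 * a ^+ n.
have [y vy] : exists y, root_norm_cvg0 (fun n => v n - y).
  apply: root_norm_cvg0_increments.
  have := root_norm_cvg0N (root_norm_cvg0Ml x (root_norm_cvg0Xl x xlim)).
  congr root_norm_cvg0; apply/funext => n.
  by rewrite /v mulrA -exprS mulrBr opprB [in RHS]exprSr mulrA.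
have axX n : a * x ^+ n.+2 = x ^+ n.+1.
  by rewrite exprS mulrA exprS mulrA -(mulrA a) -expr2 axx -exprS.
have lim_unique (u : nat -> A) z : (forall n, u n = v n) ->
    root_norm_cvg0 (fun n => u n - z) -> z = y.
  move=> uv uz; apply: (root_norm_cvg0_eq uz).
  by under eq_fun do rewrite uv.
have axy : a * x * y = y.
  apply: (lim_unique (fun n => a * x * v n)) => [n|].
    by rewrite /v mulrA -(mulrA a) -exprS axX.
  by under eq_fun do rewrite -mulrBr; exact: root_norm_cvg0Ml.
have xay : x * a * y = y.
  apply: (lim_unique (fun n => x * a * v n)) => [n|].
    by rewrite /v exprS !mulrA (outer_gdrazin_xax ax).
  by under eq_fun do rewrite -mulrBr; exact: root_norm_cvg0Ml.
have comm : a * y = y * a.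
  apply: (@root_norm_cvg0_eq _ _ (fun n => v n * a)); last first.
    by under eq_fun do rewrite -mulrBl; exact: root_norm_cvg0Mr.
  have := (root_norm_cvg0S _).2 (root_norm_cvg0Ml a vy).
  congr root_norm_cvg0; apply/funext => n.
  by rewrite mulrBr /v mulrA axX -mulrA -exprSr.
have yax : y * a * x = x.
  have xXaX n : x ^+ n * (a ^+ n * x) = x.
    elim: n => [|n IHn]; first by rewrite !expr0 !mul1r.
    by rewrite exprSr exprS -!mulrA (outer_gdrazin_xaX ax).
  apply/esym/subr0_eq/root_norm_cvg0_cst.
  have := root_norm_cvg0Mr x (root_norm_cvg0Mr a vy).
  congr root_norm_cvg0; apply/funext => n.
  by rewrite !mulrBl /v -(mulrA _ _ a) -exprSr -(mulrA _ (a ^+ _)) xXaX.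
have yay : a * y ^+ 2 = y.
  by rewrite expr2 mulrA comm -{2}xay !mulrA yax xay.
exists y; split=> //; apply/gdrazin_spectral => //.
have := root_norm_cvg0Ml (1 - a * y) (outer_gdrazin_right ax).
congr root_norm_cvg0; apply/funext => n.
rewrite mulrA mulrBr mulr1 (_ : _ * (a * x) = 0) ?subr0//.
by rewrite mulrBl mul1r -(mulrA a) (mulrA y) yax subrr.
Qed.

Lemma bc_inverse_uniq b c a x x' :
  is_bc_inverse b c a x -> is_bc_inverse b c a x' -> x = x'.
Proof.
move=> [_ cax [y xE] _] [x'ab _ _ [z x'E]].
have <- : x' * a * x = x by rewrite xE !mulrA x'ab.
by rewrite [in RHS]x'E -cax {1}x'E !mulrA.
Qed.

Lemma group_inverse_idempotent q g : q * q = q -> is_group_inverse q g -> g = q.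
Proof.
rewrite /is_group_inverse !expr2 => qq [qgg qg gqq].
rewrite qq in gqq.
by rewrite -[LHS]qgg mulrA qg gqq qg gqq.
Qed.

Lemma is_group_inverse_idempotent q : q * q = q -> is_group_inverse q q.
Proof. by rewrite /is_group_inverse !expr2 => qq; rewrite !qq. Qed.

Lemma outer_gdrazin_of_gg a x : is_gg_inverse a x -> outer_gdrazin a x.
Proof. by case. Qed.

(** For every outer g-Drazin inverse [x], the idempotent [a x] has one and the
    same range; its kernel is what distinguishes the various inverses. *)
Lemma outer_gdrazin_range a x x' : outer_gdrazin a x -> outer_gdrazin a x' ->
  a * x * (a * x') = a * x'.
Proof.
move=> ax ax'.
have : (1 - a * x) * (a * x') = 0.
  apply: (annihilates_range (w := x')) (outer_gdrazin_right ax) _.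
  by rewrite -!mulrA -expr2; case: ax' => ->.
by move/eqP; rewrite mulrBl mul1r subr_eq0 eq_sym => /eqP.
Qed.

(** The idempotents [q = a x] and [q' = a x'] have the same range.
    Self-adjointness of [a* a q] and [a* a q'] forces [a* a q = a* a q'], so that
    [(a (q - q'))* (a (q - q')) = 0] and properness gives [a q = a q'].  As [x a]
    fixes the range of [q], the idempotents agree, and so do [x] and [x']. *)
Lemma gg_inverse_uniq a x x' : proper_involution A ->
  is_gg_inverse a x -> is_gg_inverse a x' -> x = x'.
Proof.
move=> proper gx gx'.
have ax := outer_gdrazin_of_gg gx; have ax' := outer_gdrazin_of_gg gx'.
have [_ + _] := gx; have [_ + _] := gx'.
pose q := a * x; pose q' := a * x'; pose g := star a * a.
have herm z : star (star a * a ^+ 2 * z) = star a * a ^+ 2 * z ->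
    star (a * z) * g = g * (a * z).
  have -> : g * (a * z) = star a * a ^+ 2 * z by rewrite /g expr2 !mulrA.
  by move=> <-; rewrite expr2 !starM starK /g !mulrA.
move=> /herm h' /herm h; rewrite -/q in h; rewrite -/q' in h'.
have qq' : q * q' = q' by exact: outer_gdrazin_range.
have q'q : q' * q = q by exact: outer_gdrazin_range.
have gramE : g * q = g * q'.
  by rewrite -q'q mulrA -h' -mulrA -h mulrA -starM qq'.
have aq : a * q = a * q'.
  apply/subr0_eq/proper; rewrite -mulrBr starM -mulrA.
  by rewrite (mulrA (star a)) mulrBr gramE subrr mulr0.
have xaq : x * a * q = q by exact: outer_gdrazin_xaax.
have qE : q = q' by rewrite -xaq -mulrA aq -qq' !mulrA -(mulrA _ a x) xaq.
have [axx' _] := ax'.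
have qx' : q * x' = x' by rewrite qE -mulrA -expr2.
transitivity (x * a * x').
  by rewrite -{1}(outer_gdrazin_xax ax) -!mulrA -/q -/q' qE.
by rewrite -qx' mulrA xaq.
Qed.

End GDrazin.

(** * Outer g-Drazin inverses and idempotents *)

Section Spectral.
Variables (R : realType) (A : banachStarAlgType R).
Implicit Types (a b c p q s u v w x y z : A).

Lemma outer_gdrazin_idempotent a x :
  outer_gdrazin a x -> idempotent_elt (a * x).
Proof. by move=> ax; exact: outer_gdrazin_range. Qed.

(** The condition [p a = p a p] makes [p a ^ n] a power of the corner [p a p]. *)
Lemma corner_qnil a p : p * a = p * a * p ->
  qnil (p * a * p) <-> root_norm_cvg0 (fun n => p * a ^+ n).
Proof.
move=> pap; rewrite /qnil /= -pap -root_norm_cvg0S.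
rewrite -(root_norm_cvg0S (fun n => p * _)).
suff pX n : (p * a) ^+ n.+1 = p * a ^+ n.+1 by under eq_fun do rewrite pX.
elim: n => [|n IHn]; first by rewrite !expr1.
by rewrite exprS IHn mulrA -pap -mulrA -exprS.
Qed.

(** In block form with respect to the idempotent [a x], the element [a] is upper
    triangular, with a quasinilpotent lower diagonal block. *)
Lemma outer_gdrazin_corner a x (p := 1 - a * x) : outer_gdrazin a x ->
  p * a = p * a * p /\ qnil (p * a * p).
Proof.
move=> ax; have pap : p * a = p * a * p.
  rewrite {3}/p mulrBr mulr1 (_ : p * a * (a * x) = 0) ?subr0//.
  by rewrite /p mulrBl mul1r mulrBl -!mulrA (mulrA x a) (outer_gdrazin_xaax ax) subrr.
by split=> //; apply/corner_qnil/outer_gdrazin_right.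
Qed.

(** Up to an invertible factor, [x + p] is a two-sided inverse: both products
    with [a + p] are Jacobson conjugates of [1 + p a], which is invertible because
    [p a] is quasinilpotent. *)
Lemma outer_gdrazin_invertible a x : outer_gdrazin a x ->
  invertible (a + (1 - a * x)).
Proof.
move=> ax; have [pap pq] := outer_gdrazin_corner ax.
set p := 1 - a * x in pap pq *.
have px : p * x = 0.
  by rewrite mulrBl mul1r -mulrA -expr2; case: ax => ->; rewrite subrr.
have xp : x * p = 0 by rewrite mulrBr mulr1 mulrA (outer_gdrazin_xax ax) subrr.
have pp : p * p = p.
  rewrite {2}/p mulrBr mulr1 {2}/p mulrBl mul1r.
  by rewrite (outer_gdrazin_idempotent ax) subrr subr0.
have xap : x * a * p = x * a - a * x by rewrite mulrBr mulr1 (outer_gdrazin_xaax ax).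
have axp : a * x + p = 1 by rewrite subrKC.
clearbody p; have inv : invertible (1 + a * p).
  by apply/invertible_1D_swap/invertible_1D_qnil; rewrite pap.
apply: (@invertible_of_products _ _ (x + p)).
  have -> : (x + p) * (a + p) = 1 + (p + x) * (a * p).
    rewrite !mulrDl !mulrDr xp pp addr0 !mulrA -pap xap.
    rewrite -axp addrCA [RHS]addrCA (addrC (a * x)) -[in RHS](addrA p) subrKC.
    by rewrite [p + _]addrC.
  by apply/invertible_1D_swap; rewrite mulrDr -!mulrA pp px mulr0 addr0.
rewrite (_ : _ * _ = 1 + a * p)// !mulrDl !mulrDr px pp add0r.
by rewrite addrAC axp.
Qed.

(** Together with the two preceding lemmas, this identifies the outer g-Drazin
    inverses of [a] with the idempotents [p] satisfying these conditions.  With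
    [q = 1 - p], the triangular element [a + p] is invertible and so is its lower
    block, hence its upper block [q a q] is invertible in the corner [q A q]; the
    inverse of that block, [(a + p) ^ -1 q], is the desired [x]. *)
Lemma outer_gdrazin_exists a p : idempotent_elt p -> invertible (a + p) ->
  p * a = p * a * p -> qnil (p * a * p) ->
  exists2 x, outer_gdrazin a x & a * x = 1 - p.
Proof.
rewrite /idempotent_elt => pp [w [wr wl]] pap pq.
have [u [_ ul]] : invertible (1 + p * a).
  by apply: invertible_1D_qnil; rewrite pap.
pose q := 1 - p.
have pq0 : p * q = 0 by rewrite mulrBr mulr1 pp subrr.
have waq : w * (a * q) = q.
  by rewrite -[RHS]mul1r -wl -mulrA mulrDl pq0 addr0.
have pw : p * w = u * p.
  rewrite -[LHS]mul1r -ul -!mulrA (mulrA _ p w) (_ : (1 + _) * p = p * (a + p)).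
    by rewrite -(mulrA p) wr mulr1.
  by rewrite mulrDl mul1r -pap mulrDr pp addrC.
have pwq : p * (w * q) = 0 by rewrite mulrA pw -mulrA pq0 mulr0.
have awq : a * (w * q) = q.
  by rewrite -[LHS]addr0 -pwq -mulrDl mulrA wr mul1r.
exists (w * q) => //; split.
  by rewrite expr2 mulrA awq mulrBl mul1r pwq subr0.
have qaq : q * (a * q) = a * q.
  by rewrite mulrBl mul1r mulrBr mulr1 mulrBr mulrA -pap subrr subr0.
have := root_norm_cvg0Ml (1 - w * q * a) ((corner_qnil pap).1 pq).
congr root_norm_cvg0; apply/funext => n.
have wqap : (1 - w * q * a) * p = 1 - w * q * a.
  rewrite -[p](subKr 1) -/q mulrBr mulr1 mulrBl mul1r -!mulrA qaq waq.
  by rewrite subrr subr0.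
by rewrite mulrA wqap mulrBl mul1r -(mulrA _ a) -exprS.
Qed.

(** A [(b, c)]-inverse is the outer inverse with the range of [b] and the
    kernel of [c]; [x] and [a x] share their kernel, and [x] maps the range of
    [a x] onto itself. *)
Lemma bc_inverse_outer a b c x : outer_gdrazin a x ->
  is_bc_inverse b c a x <-> is_bc_inverse b c (a * x) (a * x).
Proof.
move=> ax; have [axx _] := ax; rewrite expr2 mulrA in axx.
have xax := outer_gdrazin_xax ax; have xaax := outer_gdrazin_xaax ax.
have id : a * x * (a * x) = a * x := outer_gdrazin_idempotent ax.
split=> -[xab cax [y xE] [z xE']]; rewrite /is_bc_inverse.
  have axb : a * x * b = b by rewrite -{1}xab !mulrA axx.
  rewrite id axb; split=> //.
  - by rewrite -mulrA id mulrA.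
  - by exists y; rewrite -{1}xaax {1}xE -!(mulrA (b * y)) xaax.
  - by exists (a * x * z); rewrite mulrA id {1}xE' !mulrA.
rewrite id in xab; rewrite -mulrA id in cax.
split.
- by rewrite -{1}xab mulrA -(mulrA x) (mulrA _ a) xaax.
- by rewrite -mulrA.
- by exists y; rewrite -{1}axx {1}xE -mulrA axx.
- by exists z; rewrite -{1}xax -mulrA {1}xE' !mulrA xax.
Qed.

(** An idempotent is its own group inverse. *)
Lemma group_bc_idempotent b c q : idempotent_elt q ->
  group_bc b c q <-> is_bc_inverse b c q q.
Proof.
move=> qq; have gq : group_inverse q = q.
  apply: xget_unique; first exact: is_group_inverse_idempotent.
  by move=> g; exact: group_inverse_idempotent.
rewrite /group_bc /= gq; split=> [[_ bq qE]|bq].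
  by rewrite {2}qE; exact: (xgetPex 0 bq).
split.
- by exists q; exact: is_group_inverse_idempotent.
- by exists q.
- by apply/esym/xget_unique => // y yq; exact: bc_inverse_uniq yq bq.
Qed.

Lemma gg_bcP b c a : proper_involution A ->
  gg_bc b c a <-> exists2 x, is_gg_inverse a x & is_bc_inverse b c a x.
Proof.
move=> proper; rewrite /gg_bc /=; split=> [[ga ba gb]|[x gx bx]].
  exists (gg_inverse a); first exact: (xgetPex 0 ga).
  by rewrite gb; exact: (xgetPex 0 ba).
split; [by exists x|by exists x|].
have -> : gg_inverse a = x.
  by apply: xget_unique => // y yx; exact: gg_inverse_uniq yx gx.
by apply/esym/xget_unique => // y yx; exact: bc_inverse_uniq yx bx.
Qed.

Lemma gram_compl_selfadjoint a q (g := star a * a) :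
  star (g * (1 - q)) = g * (1 - q) <-> star (g * q) = g * q.
Proof.
rewrite mulrBr mulr1 starB star_gram; split=> [|->//].
by move/addrI/oppr_inj.
Qed.

Lemma outer_gdrazin_gdrazin a y : is_gdrazin_inverse a y -> outer_gdrazin a y.
Proof.
move=> [ayy ya yq]; split=> //; have := (gdrazin_spectral ayy ya).1 yq.
congr root_norm_cvg0; apply/funext => n.
by rewrite mulrBl mul1r ya -mulrA -exprS.
Qed.

(** Write [q = a x].  The idempotents [q] and [a y] have the same range, so
    [p y = 0] and [q = y a q].  If [a* a p] is self-adjoint, it equals
    [p* a* a], and [y* a p = (y ^ 2)* a* a p = (p y ^ 2)* a* a = 0].  Conversely, [a q]
    lies in [y A], so [y* a p = 0] gives [q* a* a p = 0]; then
    [q* a* a = q* a* a q] is self-adjoint, and it is the adjoint of [a* a q]. *)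
Lemma gdrazin_orthogonal a x y (p := 1 - a * x) :
  outer_gdrazin a x -> is_gdrazin_inverse a y ->
  star (star a * a * p) = star a * a * p <-> star y * a * p = 0.
Proof.
move=> ax ay; have ya := outer_gdrazin_gdrazin ay.
have [ayy comm _] := ay; rewrite expr2 in ayy.
split=> [herm|orth].
  have py : p * y = 0.
    rewrite -ayy (mulrA a) mulrA [p * _]mulrBl mul1r.
    by rewrite (outer_gdrazin_range ax ya) subrr mul0r.
  rewrite -{1}ayy starM -!mulrA (mulrA (star a)) -herm.
  rewrite (starM (_ * a)) star_gram mulrA -starM (mulrA p) py.
  by rewrite mul0r star0 mul0r.
apply/gram_compl_selfadjoint.
have aq : a * (a * x) = y * (a * (a * (a * x))).
  rewrite -{1}(outer_gdrazin_range ya ax) !mulrA -comm -!mulrA (mulrA a y).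
  by rewrite comm !mulrA.
have orthq :
    star (a * x) * (star a * a) = star (a * x) * (star a * a) * (a * x).
  apply/eqP; rewrite -subr_eq0 -{1}[_ * (star a * a)]mulr1 -mulrBr -/p.
  have -> : star (a * x) * (star a * a) * p = star (a * (a * x)) * (a * p).
    by rewrite (starM a (a * x)) !mulrA.
  by rewrite aq (starM y) -mulrA (mulrA (star y)) orth mulr0.
have gramz z : star (star z * (star a * a) * z) = star z * (star a * a) * z.
  by rewrite !starM !starK !mulrA.
rewrite (starM (star a * a)) star_gram orthq.
by rewrite -[LHS]gramz -orthq (starM (star _)) star_gram starK.
Qed.

End Spectral.

(** * The characterization *)

Theorem theorem3p3 (R : realType) (A : banachStarAlgType R)
    (star_proper : proper_involution A) (a b c : A) :
  [<-> (* (1) *)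
       gg_bc b c a;
       (* (2) *)
       gdrazin_invertible a /\
       exists p : A, [/\ idempotent_elt p, invertible (a + p),
         group_bc b c (1 - p), star (star a * a * p) = star a * a * p &
         p * a = p * a * p /\ qnil (p * a * p)];
       (* (3) *)
       gdrazin_invertible a /\
       exists p : A, [/\ idempotent_elt p, invertible (a + p),
         group_bc b c (1 - p), star (gdrazin_inverse a) * a * p = 0 &
         p * a = p * a * p /\ qnil (p * a * p)]].
Proof.
tfae.
- move=> /(gg_bcP _ _ _ star_proper)[x gx bx].
  have ax := outer_gdrazin_of_gg gx; have qq := outer_gdrazin_idempotent ax.
  split; first exact: gdrazin_invertible_of_outer ax.
  exists (1 - a * x); split.
  + by rewrite /idempotent_elt mulrBr mulr1 mulrBl mul1r qq subrr subr0.
  + exact: outer_gdrazin_invertible.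
  + rewrite (subKr 1 (a * x)).
    apply: (group_bc_idempotent b c qq).2.
    exact: (bc_inverse_outer b c ax).1 bx.
  + apply/gram_compl_selfadjoint; case: gx => _ + _.
    by rewrite expr2 !mulrA.
  + exact: outer_gdrazin_corner.
- move=> [ad [p [pp ap gp herm [pap pq]]]]; split=> //.
  exists p; split=> //; have dy : is_gdrazin_inverse a (gdrazin_inverse a).
    exact: (xgetPex 0 ad).
  have [x ax axp] := outer_gdrazin_exists pp ap pap pq.
  have pE : p = 1 - a * x by rewrite axp subKr.
  by move: herm; rewrite pE => /(gdrazin_orthogonal ax dy).
move=> [ad [p [pp ap gp orth [pap pq]]]]; apply/(gg_bcP _ _ _ star_proper).
have dy : is_gdrazin_inverse a (gdrazin_inverse a) by exact: (xgetPex 0 ad).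
have [x ax axp] := outer_gdrazin_exists pp ap pap pq.
have pE : p = 1 - a * x by rewrite axp subKr.
exists x.
  have [axx lim] := ax; split=> //.
  move: orth; rewrite pE => /(gdrazin_orthogonal ax dy)/gram_compl_selfadjoint.
  by rewrite expr2 !mulrA.
apply/(bc_inverse_outer _ _ ax)/group_bc_idempotent; last by rewrite axp.
exact: outer_gdrazin_idempotent.
Qed.
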